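(* Let $\Delta$ be any Hadamard simplex of dimension $d$ and let $m,n$ be positive odd integers with $n<m<dn$. Then the polytope $P_{m,n}=m\Delta\cap[-n,n]^d$ is smooth in $\Lambda_n=(n+2\mathbb Z)^d$ if and only if $$m>\frac{d-1}{2}\,n\qquad\text{and}\qquad \frac mn\notin 2\mathbb Z+1 .$$ Moreover, whenever $m>\frac{d-1}{2}n$ (including when $m/n$ is an odd integer), $P_{m,n}$ is a lattice polytope in $\Lambda_n$.
   Context: Hadamard simplices: let $H$ be a real Hadamard matrix of order $N$ (an $N\times N$ matrix with entries $\pm1$ and $HH^{\mathsf T}=NI$). Mark one column of $H$, multiply rows by signs so that this column becomes all ones, and delete it. With $d=N-1$, the remaining rows $v_0,\dots,v_{N-1}\in\{\pm1\}^d$ satisfy $v_i\cdot v_j=N\delta_{ij}-1$ and $\sum_i v_i=0$. The Hadamard simplex is $\Delta=\operatorname{conv}\{v_0,\dots,v_{N-1}\}\subset\mathbb R^d$; equivalently $\Delta=\{x: v_i\cdot x\ge -1\ \forall i\}$. $P_{m,n}$ is a lattice polytope in $\Lambda_n$ if all its vertices lie in $\Lambda_n$. The integer chart $x\mapsto y=(x+n\mathbf 1)/2$ ($\mathbf 1$ the all-ones vector) maps $\Lambda_n$ onto $\mathbb Z^d$ and $P_{m,n}$ onto $$Q_{m,n}=\{y\in[0,n]^d: v_i\cdot y\ge b_i\ \forall i\},\qquad b_i=\tfrac12\Bigl(n\sum_j (v_i)_j-m\Bigr).$$ $P_{m,n}$ is smooth in $\Lambda_n$ if it is a lattice polytope and,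 at each vertex of $Q_{m,n}$, the primitive integer normal vectors of all the facets of $Q_{m,n}$ containing that vertex form a basis of the dual lattice, identified with $\mathbb Z^d$. *)

(* Defs.v *)
From mathcomp Require Import all_boot all_order all_algebra.
From mathcomp Require Import boolp classical_sets reals.
From mathcomp Require Import ring lra.

Set Implicit Arguments.
Unset Strict Implicit.
Unset Printing Implicit Defensive.

Import Order.TTheory GRing.Theory Num.Theory.

Local Open Scope classical_set_scope.
Local Open Scope ring_scope.

Section Polytopes.
Variables (R : realFieldType) (d : nat).
Implicit Types (P F : set 'rV[R]_d) (x y : 'rV[R]_d).

Definition dot x y : R := \sum_j x 0 j * y 0 j.

Definition conv (N : nat) (v : 'I_N -> 'rV[R]_d) : set 'rV[R]_d :=
  [set x | exists w : 'I_N -> R,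
     [/\ forall i, 0 <= w i, \sum_i w i = 1 & x = \sum_i w i *: v i]].

(* The inequality [b <= dot u y] is valid on P, and F is where it is tight;
   F = P and F = set0 are allowed. *)
Definition cuts_face P F (u : 'rV[R]_d) (b : R) : Prop :=
  (forall y, P y -> b <= dot u y) /\ F = P `&` [set y | dot u y = b].

Definition face P F : Prop := exists u b, cuts_face P F u b.

(* The rows of B form a basis of the direction space of the affine hull of A,
   so the dimension of A is k; the empty set has no dimension. *)
Definition has_dim (A : set 'rV[R]_d) (k : nat) : Prop :=
  exists x0 (B : 'M[R]_(k, d)),
    [/\ A x0, row_free B, forall i, A (x0 + row i B) &
        forall x, A x -> (x - x0 <= B)%MS].

Definition facet P F : Prop :=
  face P F /\ exists k, has_dim P k.+1 /\ has_dim F k.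

Definition vertex P x : Prop := face P [set x].

Definition primitive (u : 'rV[int]_d) : Prop :=
  \big[gcdn/0%N]_j absz (u 0 j) = 1%N.

(* Inner normals; when P is full-dimensional, each facet has at most one. *)
Definition primitive_normal P F (u : 'rV[int]_d) : Prop :=
  primitive u /\ exists b, cuts_face P F (map_mx intr u) b.

Definition normals_at P x : set 'rV[int]_d :=
  [set u | exists F, [/\ facet P F, F x & primitive_normal P F u]].

Definition Zbasis (S : set 'rV[int]_d) : Prop :=
  exists k (B : 'M[int]_(k, d)),
    S = range (fun i => row i B) /\
    forall z : 'rV[int]_d, exists! c : 'rV[int]_k, z = c *m B.

End Polytopes.

Section HadamardSimplex.
Variables (R : realFieldType) (d : nat).

Definition hadamard (N : nat) (H : 'M[R]_N) : Prop :=
  (forall i j, H i j = 1 \/ H i j = -1) /\ H *m H^T = (N%:R)%:M.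

Variables (H : 'M[R]_d.+1) (c : 'I_d.+1).

(* Row i of H, with the sign H i c making its entry in the marked column c
   equal to 1, and that entry deleted. *)
Definition hvertex (i : 'I_d.+1) : 'rV[R]_d := H i c *: col' c (row i H).

Definition hsimplex : set 'rV[R]_d := conv hvertex.

Definition cube (n : nat) : set 'rV[R]_d :=
  [set x | forall j, - n%:R <= x 0 j <= n%:R].

Definition Pmn (m n : nat) : set 'rV[R]_d :=
  [set m%:R *: x | x in hsimplex] `&` cube n.

Definition Lambda (n : nat) : set 'rV[R]_d :=
  [set x | forall j, exists k : int, x 0 j = n%:R + 2 * k%:~R].

Definition chart (n : nat) (x : 'rV[R]_d) : 'rV[R]_d :=
  2^-1 *: (x + const_mx n%:R).

Definition bQ (m n : nat) (i : 'I_d.+1) : R :=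
  2^-1 * (n%:R * \sum_j hvertex i 0 j - m%:R).

Definition Qmn (m n : nat) : set 'rV[R]_d :=
  [set y : 'rV[R]_d | (forall j, 0 <= y 0 j <= n%:R) /\
           forall i, bQ m n i <= dot (hvertex i) y].

Definition lattice_polytope_P (m n : nat) : Prop :=
  forall x, vertex (Pmn m n) x -> Lambda n x.

Definition smooth_P (m n : nat) : Prop :=
  lattice_polytope_P m n /\
  forall y, vertex (Qmn m n) y -> Zbasis (normals_at (Qmn m n) y).

Lemma hvertexE i j : hvertex i 0 j = H i c * H i (lift c j).
Proof. by rewrite !mxE. Qed.

Hypothesis hH : hadamard H.

Lemma hadamard_sqr i j : H i j * H i j = 1.
Proof. by case: (hH.1 i j) => ->; ring. Qed.

Lemma hadamard_row i j : \sum_k H i k * H j k = (d.+1)%:R * (i == j)%:R.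
Proof.
have := congr1 (fun A : 'M_ _ => A i j) hH.2; rewrite !mxE => E.
by rewrite mulr_natr -E; apply: eq_bigr => k _; rewrite mxE.
Qed.

Lemma hadamard_col i j : \sum_k H k i * H k j = (d.+1)%:R * (i == j)%:R.
Proof.
have N0 : (d.+1%:R : R) != 0 by rewrite pnatr_eq0.
have E : H^T *m H = (d.+1%:R)%:M.
  have E1 : H *m (d.+1%:R^-1 *: H^T) = 1%:M.
    by rewrite -scalemxAr hH.2 scale_scalar_mx mulVf.
  have := mulmx1C E1; rewrite -scalemxAl => E2.
  by rewrite -[LHS](scalerKV N0) E2 scale_scalar_mx mulr1.
have := congr1 (fun A : 'M_ _ => A i j) E; rewrite !mxE => E'.
by rewrite mulr_natr -E'; apply: eq_bigr => k _; rewrite mxE.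
Qed.

Lemma sum_lift (F : 'I_d.+1 -> R) : \sum_k F k = F c + \sum_j F (lift c j).
Proof.
rewrite (bigD1 c) //=; congr (_ + _).
rewrite (reindex_omap (lift c) (unlift c)) /=.
  by apply: eq_bigl => j; rewrite liftK eqxx andbT eq_sym neq_lift.
by move=> k kc; case: unliftP kc => [j ->|->] //; rewrite eqxx.
Qed.

Lemma dot_hvertex i k :
  dot (hvertex i) (hvertex k) = (d.+1)%:R * (i == k)%:R - 1.
Proof.
have E := hadamard_row i k; rewrite sum_lift in E.
have -> : dot (hvertex i) (hvertex k) =
          H i c * H k c * \sum_j H i (lift c j) * H k (lift c j).
  by rewrite /dot mulr_sumr; apply: eq_bigr => j _; rewrite !hvertexE; ring.
move: E => /(canRL (addKr _)) ->; case: eqVneq => [->|_].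
  by rewrite hadamard_sqr; ring.
rewrite mulr0 addr0 sub0r mulrN.
by congr (- _); rewrite mulrACA !hadamard_sqr mulr1.
Qed.

Lemma sum_hvertex : \sum_i hvertex i = 0.
Proof.
apply/rowP => j; rewrite summxE mxE.
under eq_bigr do rewrite hvertexE.
by rewrite hadamard_col (negPf (neq_lift _ _)) mulr0.
Qed.

Lemma dotDr (u x y : 'rV[R]_d) : dot u (x + y) = dot u x + dot u y.
Proof. by rewrite -big_split; apply: eq_bigr => j _; rewrite mxE mulrDr. Qed.

Lemma dotZr (u : 'rV[R]_d) a x : dot u (a *: x) = a * dot u x.
Proof. by rewrite mulr_sumr; apply: eq_bigr => j _; rewrite mxE; ring. Qed.

Lemma dot_sumr (u : 'rV[R]_d) N (w : 'I_N -> R) (p : 'I_N -> 'rV[R]_d) :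
  dot u (\sum_i w i *: p i) = \sum_i w i * dot u (p i).
Proof.
elim/big_ind2: _ => [|x a y b <- <-|i _]; last by rewrite dotZr.
  by rewrite /dot big1 // => j _; rewrite mxE mulr0.
by rewrite dotDr.
Qed.

Lemma dot_suml (x : 'rV[R]_d) N (p : 'I_N -> 'rV[R]_d) :
  \sum_i dot (p i) x = dot (\sum_i p i) x.
Proof.
rewrite /dot exchange_big; apply: eq_bigr => j _.
by rewrite summxE mulr_suml.
Qed.

Lemma hsimplexE : hsimplex = [set x | forall i, -1 <= dot (hvertex i) x].
Proof.
have N0 : 0 < (d.+1%:R : R) by rewrite ltr0n.
apply/seteqP; split => [x [w [w0 w1 ->]] i /=|x hx].
  rewrite dot_sumr.
  under eq_bigr do rewrite dot_hvertex mulrBr mulr1.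
  rewrite sumrB w1 lerBrDl subrr; apply: sumr_ge0 => k _.
  by rewrite !mulr_ge0 ?ler0n.
exists (fun i => (1 + dot (hvertex i) x) / d.+1%:R); split.
- by move=> i; rewrite divr_ge0 ?(ltW N0) // -lerBlDl sub0r; exact: hx.
- rewrite -mulr_suml big_split /= dot_suml sum_hvertex.
  rewrite [dot 0 x]big1 => [|j _]; last by rewrite mxE mul0r.
  by rewrite sumr_const card_ord addr0 mulfV // gt_eqF.
under eq_bigr => i _ do rewrite mulrC -scalerA scalerDl scale1r.
rewrite -scaler_sumr big_split /= sum_hvertex add0r.
apply/rowP => k; rewrite mxE summxE.
under eq_bigr => i _ do rewrite mxE /dot mulr_suml.
rewrite exchange_big /=.
have E j : \sum_i hvertex i 0 j * x 0 j * hvertex i 0 k =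
           x 0 j * (d.+1%:R * (j == k)%:R).
  rewrite -(inj_eq (@lift_inj _ c)) -hadamard_col mulr_sumr.
  apply: eq_bigr => i _; rewrite !hvertexE.
  have S := hadamard_sqr i c.
  by transitivity (H i c * H i c * (x 0 j * (H i (lift c j) * H i (lift c k))));
    [ring | rewrite S mul1r].
under eq_bigr do rewrite E.
rewrite (bigD1 k) //= big1 => [|j /negPf->]; last by rewrite !mulr0.
by rewrite eqxx addr0 mulr1 mulrCA mulVf ?mulr1 // gt_eqF.
Qed.

Lemma chart_Pmn m n : (0 < m)%N -> [set chart n x | x in Pmn m n] = Qmn m n.
Proof.
move=> m_gt0; have m0 : 0 < (m%:R : R) by rewrite ltr0n.
have dotE i x : dot (hvertex i) (chart n x) - bQ m n i =
                2^-1 * (dot (hvertex i) x + m%:R).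
  rewrite /chart /bQ dotZr dotDr.
  have -> : dot (hvertex i) (const_mx n%:R) = n%:R * \sum_j hvertex i 0 j.
    by rewrite mulr_sumr; apply: eq_bigr => j _; rewrite [const_mx _ _ _]mxE mulrC.
  by ring.
have halfE a : (0 <= 2^-1 * a :> R) = (0 <= a).
  by rewrite pmulr_rge0 // invr_gt0 ltr0n.
have PE x : Pmn m n x <->
    (forall i, 0 <= dot (hvertex i) x + m%:R) /\ cube n x.
  rewrite /Pmn hsimplexE; split => [[[z /= hz <-] cx]|[hx cx]]; split => //.
    move=> i; rewrite dotZr; have := hz i; nra.
  exists (m%:R^-1 *: x); last by rewrite scalerA mulfV ?scale1r // gt_eqF.
  move=> i; rewrite dotZr -(ler_pM2l m0) mulrA mulfV ?gt_eqF // mul1r.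
  by have := hx i; lra.
apply/seteqP; split => [_ [x /PE [hx cx] <-]|y [cy hy]].
  split=> [j|i]; first by rewrite !mxE; have := cx j; lra.
  by rewrite -subr_ge0 dotE halfE.
exists (2 *: y - const_mx n%:R); last first.
  by apply/rowP => j; rewrite !mxE; field.
have E : chart n (2 *: y - const_mx n%:R) = y.
  by apply/rowP => j; rewrite !mxE; field.
apply/PE; split=> [i|j]; last by rewrite !mxE; have := cy j; lra.
by rewrite -halfE -dotE E subr_ge0.
Qed.

End HadamardSimplex.

(* Main.v *)
Require Import Defs.
From mathcomp Require Import all_boot all_order all_algebra.
From mathcomp Require Import boolp classical_sets reals.
From mathcomp Require Import ring lra zify.

Set Implicit Arguments.
Unset Strict Implicit.
Unset Printing Implicit Defensive.

Import Order.TTheory GRing.Theory Num.Theory.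
Local Open Scope classical_set_scope.
Local Open Scope ring_scope.

(** Both [Pmn] and its chart image [Qmn] are cut out by the same integer normals:
the rows [v i] of the simplex and the signed axes of the cube.  Since
[n < m < d n], each of these inequalities defines a facet: the point
[- (m / d) v i] of the i-th simplex facet is interior to the cube, and the
centre of each cube facet is interior to the simplex.  Hence the primitive facet
normals at a point are exactly the normals of the inequalities that are tight
there ([normals_at_polyh], [normals_chart]), and a point is a vertex exactly when
its tight normals span ([vertex_polyhP]).

The threshold [(d-1)/2 n] decides whether two simplex facets can meet inside the
cube.  Two distinct rows satisfy [v i . v k = -1], so
[v i + v k] has entries [0] and [+-2] with absolute values summing to [d - 1],
and on the cube [(v i + v k) . x >= - (d - 1) n] ([dot_pair_ge]).

If [m] is above the threshold, then at most one simplex facet passes through any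
point, so a vertex has all coordinates [+-n] except possibly one, which is then
determined by one equation [v i . x = - m] ([vertex_coords]).  As [d], [m] and
[n] are odd and [v i] has entries [+-1], this last coordinate is an odd integer:
the polytope is a lattice polytope.  The tight normals are [d - 1] signed axes
together with the missing axis or with [v i], a lattice basis
([Zbasis_star]), unless a cube vertex lies on a simplex facet; the latter
forces [m / n] to be an odd integer ([cube_vertex_ratio]).

Conversely, if [m] is at most the threshold, the point [- m / (d - 1) (v i + v k)]
lies in the polytope and on two simplex facets, and so some vertex lies on both
([exists_vertex]).  The two normals are congruent modulo 2, hence not part
of a basis ([Zbasis_congr2]).  If [m] is above the threshold and [m / n] is
an odd integer, some cube vertex lies on a simplex facet; its [d + 1] normals
are not independent ([Zbasis_axes]). *)

(** * Dot products and polyhedra *)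

Section DotProduct.
Variables (R : realFieldType) (d : nat).
Implicit Types (u x y : 'rV[R]_d).

Lemma dotC x y : dot x y = dot y x.
Proof. by apply: eq_bigr => j _; rewrite mulrC. Qed.

Lemma dotNr u x : dot u (- x) = - dot u x.
Proof. by rewrite -scaleN1r dotZr mulN1r. Qed.

Lemma dotBr u x y : dot u (x - y) = dot u x - dot u y.
Proof. by rewrite dotDr dotNr. Qed.

Lemma dotDl u x y : dot (x + y) u = dot x u + dot y u.
Proof. by rewrite dotC dotDr !(dotC u). Qed.

Lemma dotZl u k x : dot (k *: x) u = k * dot x u.
Proof. by rewrite dotC dotZr dotC. Qed.

Lemma dot0r u : dot u 0 = 0.
Proof. by rewrite -(scale0r 0) dotZr mul0r. Qed.

Lemma dot_delta u j : dot u (delta_mx 0 j) = u 0 j.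
Proof.
rewrite /dot (bigD1 j) //= big1 => [|k /negPf jk]; rewrite mxE ?jk ?mulr0 //.
by rewrite !eqxx mulr1 addr0.
Qed.

Lemma dot_ge0 x : 0 <= dot x x.
Proof. by apply: sumr_ge0 => j _; rewrite -expr2 sqr_ge0. Qed.

Lemma dot_eq0 x : dot x x = 0 -> x = 0.
Proof.
move=> /eqP; rewrite psumr_eq0 => [/allP x0|j _]; last by rewrite -expr2 sqr_ge0.
apply/rowP => j; have := x0 j (mem_index_enum j).
by rewrite mulf_eq0 orbb mxE => /eqP.
Qed.

Lemma dot_mulmx u x : x *m u^T = (dot u x)%:M.
Proof.
apply/matrixP => i j; rewrite !ord1 !mxE eqxx mulr1n.
by apply: eq_bigr => k _; rewrite mxE mulrC.
Qed.

Lemma sub_kermx_dot u x : (x <= kermx u^T)%MS = (dot u x == 0).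
Proof.
rewrite (sameP sub_kermxP eqP) dot_mulmx; apply/eqP/eqP => [/matrixP|->].
  by move=> /(_ 0 0); rewrite !mxE eqxx.
by apply/matrixP => i j; rewrite !mxE mul0rn.
Qed.

End DotProduct.

(** Finitely many strict inequalities survive a small enough displacement; this
is the only form of openness needed here. *)
Lemma small_step (R : realFieldType) (T : finType) (s e : T -> R) :
  (forall t, 0 < s t) -> exists2 eps : R, 0 < eps & forall t, eps * `|e t| < s t.
Proof.
move=> s0; pose M := 1 + \sum_t `|e t| / s t.
have q0 t : 0 <= `|e t| / s t by rewrite divr_ge0 // ltW.
have M0 : 0 < M by rewrite ltr_pwDl // sumr_ge0.
exists M^-1 => [|t]; first by rewrite invr_gt0.
rewrite ltr_pdivrMl // -ltr_pdivrMr // /M (bigD1 t) //=.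
have : 0 <= \sum_(i | i != t) `|e i| / s i by exact: sumr_ge0.
lra.
Qed.

(** A set lying in [p + U] has the dimension of [U] as soon as a small multiple of
every finite family of vectors of [U] can be added to [p]. *)
Lemma has_dim_relint (R : realFieldType) (d : nat) (A : set 'rV[R]_d) p
    (U : 'M[R]_d) :
  A p ->
  (forall k (B : 'M[R]_(k, d)), (B <= U)%MS ->
     exists2 eps : R, 0 < eps & forall r, A (p + eps *: row r B)) ->
  (forall x, A x -> (x - p <= U)%MS) ->
  has_dim A (\rank U).
Proof.
move=> Ap step AU.
have [|eps e0 hB] := step _ (row_base U); first by rewrite eq_row_base.
have en0 : eps != 0 by rewrite gt_eqF.
exists p, (eps *: row_base U); split=> //.
- by rewrite /row_free mxrank_scale_nz // -/(row_free _) row_base_free.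
- by move=> r; rewrite linearZ; exact: hB.
move=> x /AU xU; apply: submx_trans xU _.
by rewrite (eqmx_scale _ en0) eq_row_base.
Qed.

Section Polyhedron.
Variables (R : realFieldType) (d : nat) (I : finType).
Variables (a : I -> 'rV[R]_d) (b : I -> R).
Implicit Types (x y z : 'rV[R]_d).

Definition polyh : set 'rV[R]_d := [set x | forall i, b i <= dot (a i) x].

Definition tight i x := dot (a i) x == b i.

Lemma slack_gt0 i x : polyh x -> ~~ tight i x -> 0 < dot (a i) x - b i.
Proof. by move=> /(_ i) Px ti; rewrite subr_gt0 lt_neqAle eq_sym ti. Qed.

(** Only the tight inequalities restrict the directions in which one can move
back and forth. *)
Lemma move_tight k (B : 'M[R]_(k, d)) x : polyh x ->
  (forall i r, tight i x -> dot (a i) (row r B) = 0) ->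
  exists2 eps : R, 0 < eps &
    forall r, polyh (x + eps *: row r B) /\ polyh (x - eps *: row r B).
Proof.
move=> Px kill.
pose s (t : I * 'I_k) := if tight t.1 x then 1 else dot (a t.1) x - b t.1.
have s0 t : 0 < s t.
  by rewrite /s; case: ifP => // /negbT; exact: slack_gt0.
have [eps e0 small] := small_step (fun t => dot (a t.1) (row t.2 B)) s0.
exists eps => // r.
suff E i : `|eps * dot (a i) (row r B)| <= dot (a i) x - b i.
  split=> i; have := E i; rewrite ler_norml ?dotBr ?dotDr dotZr => /andP[]; lra.
rewrite normrM gtr0_norm //; have := small (i, r); rewrite /s /=.
by case: ifP => [/[dup] t /(kill _ r) -> _|_ /ltW //]; rewrite normr0 mulr0 subr_ge0.
Qed.

(** A nonzero vector killed by the tight normals spans a segment around [x] inside the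
polyhedron, and no linear form has [x] as its unique minimum there.
Conversely, the sum of the tight normals is such a form when they span. *)
Lemma vertex_polyhP x : vertex polyh x <->
  polyh x /\ forall z, (forall i, tight i x -> dot (a i) z = 0) -> z = 0.
Proof.
split=> [[u [beta [valid E]]]|[Px full]].
  have [Px ux] : (polyh `&` [set y | dot u y = beta]) x by rewrite -E.
  split=> // z kill.
  have [|eps e0 /(_ 0) []] := @move_tight _ z x Px.
    by move=> i r ti; rewrite row_id; exact: kill.
  rewrite row_id => Pp Pm.
  have uz : dot u z = 0.
    have := valid _ Pp; have := valid _ Pm.
    rewrite dotBr dotDr dotZr [dot u x]ux => ? ?.
    have /eqP : eps * dot u z = 0 by lra.
    by rewrite mulf_eq0 gt_eqF //= => /eqP.
  have : [set x] (x + eps *: z).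
    by rewrite E; split=> //=; rewrite dotDr dotZr uz mulr0 addr0.
  move=> /= /(canRL (addKr _)); rewrite addNr => /eqP.
  by rewrite scaler_eq0 gt_eqF //= => /eqP.
pose u := \sum_(i | tight i x) a i.
have uE y : dot u y = \sum_(i | tight i x) dot (a i) y.
  rewrite /u /dot exchange_big; apply: eq_bigr => j _.
  by rewrite summxE mulr_suml.
exists u, (\sum_(i | tight i x) b i); split=> [y Py|].
  by rewrite uE; apply: ler_sum => i _; exact: Py.
apply/seteqP; split=> [y /= ->|y [Py /= uy]] /=.
  by split=> //=; rewrite uE; apply: eq_bigr => i /eqP.
apply/eqP; rewrite -subr_eq0; apply/eqP/full => i ti.
rewrite dotBr (eqP ti); apply/eqP.
have S0 : \sum_(i | tight i x) (dot (a i) y - b i) = 0.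
  by rewrite sumrB -uE uy subrr.
move/eqP: S0; rewrite psumr_eq0 => [/allP/(_ i (mem_index_enum i))|k _].
  by rewrite ti.
by rewrite subr_ge0; exact: Py.
Qed.

(** As long as the tight normals at a point do not span, moving along a vector
that they kill until a new inequality becomes tight keeps the old ones tight.
The hypothesis makes the polyhedron bounded, so that the motion does stop. *)
Lemma exists_vertex x0 : (forall z, z != 0 -> exists i, dot (a i) z < 0) ->
  polyh x0 ->
  exists2 x, vertex polyh x & forall i, tight i x0 -> tight i x.
Proof.
move=> bounded.
have [k] := ubnP #|[pred i | ~~ tight i x0]|.
elim: k x0 => // k IH x0; rewrite ltnS => lek Px.
have [full|] := pselect (forall z, (forall i, tight i x0 -> dot (a i) z = 0) -> z = 0).
  by exists x0 => //; apply/vertex_polyhP.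
move=> /existsNP [z /not_implyP [kill /eqP z0]].
have [i0 i0z] := bounded z z0.
pose ratio i := (dot (a i) x0 - b i) / - dot (a i) z.
case: (@arg_minP _ _ _ i0 (fun i => dot (a i) z < 0) ratio i0z) => i iz imin.
pose y := x0 + ratio i *: z.
have r0 : 0 <= ratio i by rewrite divr_ge0 ?subr_ge0 //; lra.
have Py : polyh y.
  move=> l; rewrite dotDr dotZr; have [lz|] := ltP (dot (a l) z) 0; last first.
    by move=> lz; have := mulr_ge0 r0 lz; have := Px l; lra.
  have := imin l lz; rewrite {2}/ratio ler_pdivlMr; lra.
have old l : tight l x0 -> tight l y.
  by move=> tl; rewrite /tight dotDr dotZr kill // mulr0 addr0.
have new : tight i y.
  by rewrite /tight dotDr dotZr /ratio; apply/eqP; field; lra.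
have [|x vx tx] := IH y _ Py; last by exists x => // l /old /tx.
apply: leq_trans lek; apply: proper_card; apply/properP; split.
  by apply/fintype.subsetP => l; rewrite !inE; exact: contra (old l).
exists i; rewrite !inE ?new //; apply/negP => /kill iz0.
by rewrite iz0 ltxx in iz.
Qed.

End Polyhedron.

(** * Facets of an irredundant integer polyhedron *)

Lemma primitive_neq0 (d : nat) (u : 'rV[int]_d) : primitive u -> u != 0.
Proof.
move=> pu; apply/eqP => u0; move: pu; rewrite /primitive u0 big1 // => j _.
by rewrite mxE.
Qed.

(** With [v j <> 0], cross multiplication gives [v j * u = u j * v]; comparing the
gcds of the entries yields [|v j| = |u j|], so the ratio is 1. *)
Lemma primitive_ratio (R : realFieldType) (d : nat) (u v : 'rV[int]_d) (k : R) :
  primitive u -> primitive v -> 0 < k ->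
  map_mx intr u = k *: map_mx intr v -> u = v.
Proof.
move=> pu pv k0 E.
have Ej j : (u 0 j)%:~R = k * (v 0 j)%:~R :> R.
  by have /rowP/(_ j) := E; rewrite !mxE.
have /rV0Pn [j vj] := primitive_neq0 pv.
have cross i : v 0 j * u 0 i = u 0 j * v 0 i.
  by apply/eqP; rewrite -(eqr_int R) !rmorphM /= !Ej mulrCA mulrA.
have gcdM l (w : 'rV[int]_d) : \big[gcdn/0%N]_i absz (l * w 0 i) =
    (absz l * \big[gcdn/0%N]_i absz (w 0%R i))%N.
  rewrite (big_morph _ (fun x y => muln_gcdr (absz l) x y) (muln0 _)).
  by apply: eq_bigr => i _; rewrite abszM.
have Eabs : absz (v 0 j) = absz (u 0 j).
  have := gcdM (v 0 j) u; rewrite [X in (_ * X)%N]pu muln1 => <-.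
  under eq_bigr do rewrite cross.
  by rewrite gcdM [X in (_ * X)%N]pv muln1.
have k1 : k = 1.
  have vjR : `|(v 0 j)%:~R| != 0 :> R by rewrite normr_eq0 intr_eq0.
  apply: (mulIf vjR); rewrite mul1r -{1}(gtr0_norm k0) -normrM -Ej.
  by rewrite -!intr_norm -!abszE Eabs.
apply/rowP => i; apply/eqP; rewrite -(eqr_int R) Ej k1 mul1r.
by [].
Qed.

Section Normals.
Variables (R : realFieldType) (d : nat) (I : finType).
Variables (aZ : I -> 'rV[int]_d) (b : I -> R) (o : 'rV[R]_d).
Let a i : 'rV[R]_d := map_mx intr (aZ i).
Hypothesis prim : forall i, primitive (aZ i).
Hypothesis o_int : forall i, b i < dot (a i) o.
Hypothesis irredundant :
  forall i, exists2 x, polyh a b x & forall k, tight a b k x = (k == i).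
Implicit Types (x y z : 'rV[R]_d).

Lemma normal_neq0 i : a i != 0.
Proof.
have /rV0Pn [j h] := primitive_neq0 (prim i).
by apply/rV0Pn; exists j; rewrite mxE intr_eq0.
Qed.

Lemma polyh_interior : polyh a b o.
Proof. by move=> i; exact: ltW. Qed.

Lemma interior_not_tight i : tight a b i o = false.
Proof. by rewrite /tight gt_eqF. Qed.

Lemma has_dim_polyh : has_dim (polyh a b) d.
Proof.
rewrite -[X in has_dim _ X](mxrank1 R); apply: (@has_dim_relint _ _ _ o).
- exact: polyh_interior.
- move=> k B _; have [|e e0 h] := move_tight (B := B) polyh_interior.
    by move=> i r; rewrite interior_not_tight.
  by exists e => // r; have [] := h r.
by move=> x _; exact: submx1.
Qed.

(** The interior point [o] can be moved along each axis, so the direction space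
contains all the axes. *)
Lemma has_dim_polyh_eq k : has_dim (polyh a b) k -> k = d.
Proof.
move=> [x0 [B [_ /eqP rB _ sub]]]; apply/eqP; rewrite -[X in X == _]rB -/(row_full B) -sub1mx.
apply/row_subP => j; rewrite row1.
have [|e e0 /(_ 0) []] := move_tight (B := delta_mx 0 j : 'rV[R]_d) polyh_interior.
  by move=> i r; rewrite interior_not_tight.
rewrite row_id => /sub h1 _.
have := sub _ polyh_interior.
rewrite -(eqmx_opp (o - x0)) => h0; have := addmx_sub h1 h0.
rewrite opprB addrA subrK addrAC addrN add0r (eqmx_scale _ _) ?gt_eqF //.
Qed.

Lemma has_dim_tight i : has_dim (polyh a b `&` [set y | dot (a i) y = b i]) d.-1.
Proof.
have [p Pp tp] := irredundant i.
have pi : dot (a i) p = b i by apply/eqP; rewrite -/(tight a b i p) tp.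
have -> : d.-1 = \rank (kermx (a i)^T).
  by rewrite mxrank_ker mxrank_tr rank_rV normal_neq0 subn1.
apply: (@has_dim_relint _ _ _ p) => //.
- move=> k B /row_subP BK.
  have kill r : dot (a i) (row r B) = 0.
    by apply/eqP; rewrite -sub_kermx_dot BK.
  have [|e e0 h] := move_tight (B := B) Pp.
    by move=> l r; rewrite tp => /eqP ->.
  by exists e => // r; have [Pr _] := h r; split=> //=; rewrite dotDr dotZr kill mulr0 addr0.
by move=> x [_ /= xi]; rewrite sub_kermx_dot dotBr xi pi subrr.
Qed.

Lemma facet_tight : (0 < d)%N -> forall i,
  facet (polyh a b) (polyh a b `&` [set y | dot (a i) y = b i]).
Proof.
move=> d0 i; split; first by exists (a i), (b i); split=> // y; exact.
by exists d.-1; rewrite prednK //; split; [exact: has_dim_polyh|exact: has_dim_tight].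
Qed.

(** The barycentre [p] of affinely independent points spanning a facet [F] lies
on [F], so it cannot be interior: otherwise one could move from [p] against [u].
An inequality [i] tight at [p] is tight at all these points, hence on all of
[F]; as [F] has codimension 1, its normals are proportional to [a i], and the
interior point [o] fixes the sign. *)
Lemma facet_tightP F x u : facet (polyh a b) F -> F x ->
  primitive_normal (polyh a b) F u -> exists2 i, tight a b i x & u = aZ i.
Proof.
move=> [_ [k [/has_dim_polyh_eq dk [p0 [B [Fp0 freeB FB subB]]]]]] Fx.
move=> [pu [beta [valid FE]]].
pose uR : 'rV[R]_d := map_mx intr u.
have FP y : F y -> polyh a b y by rewrite FE => -[].
have Fu y : F y -> dot uR y = beta by rewrite FE => -[].
have u0 : uR != 0.
  have /rV0Pn [j h] := primitive_neq0 pu.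
  by apply/rV0Pn; exists j; rewrite mxE intr_eq0.
pose p := p0 + k.+1%:R^-1 *: \sum_r row r B.
have uB r : dot uR (row r B) = 0.
  by have := Fu _ (FB r); rewrite dotDr Fu // => /(canRL (addKr _)); rewrite addNr.
have dot_sum (w : 'rV[R]_d) : dot w (\sum_r row r B) = \sum_r dot w (row r B).
  by rewrite -[LHS]dotC -dot_suml; apply: eq_bigr => r _; rewrite dotC.
have k0 : 0 < (k.+1%:R : R) by rewrite ltr0n.
have slackp i : dot (a i) p - b i = k.+1%:R^-1 *
    (dot (a i) p0 - b i + \sum_r (dot (a i) (p0 + row r B) - b i)).
  under eq_bigr do rewrite dotDr addrAC.
  rewrite big_split /= sumr_const card_ord /p dotDr dotZr dot_sum -(mulr_natl _ k).
  apply: (canRL (mulKf _)); rewrite ?gt_eqF //.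
  by rewrite mulrBr mulrDr mulVKf ?gt_eqF // -!natr1; ring.
have slack_ge0 i y : F y -> 0 <= dot (a i) y - b i.
  by move=> /FP /(_ i); rewrite subr_ge0.
have Pp : polyh a b p.
  move=> i; rewrite -subr_ge0 slackp mulr_ge0 ?invr_ge0 ?(ltW k0) //.
  by rewrite addr_ge0 ?slack_ge0 // sumr_ge0 // => r _; exact: slack_ge0.
have up : dot uR p = beta.
  by rewrite dotDr dotZr dot_sum big1 ?mulr0 ?addr0 ?Fu.
have [i ti] : exists i, tight a b i p.
  apply: contrapT => noti; case/eqP: u0; apply: dot_eq0.
  have [|e e0 /(_ 0) [_]] := move_tight (B := uR) Pp.
    by move=> i r ti; case: noti; exists i.
  rewrite row_id => /valid; rewrite dotBr dotZr -/uR up => h.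
  have := dot_ge0 uR; have := mulr_ge0 (ltW e0) (dot_ge0 uR) => *.
  have /eqP : e * dot uR uR = 0 by lra.
  by rewrite mulf_eq0 gt_eqF //= => /eqP.
have slack0 : dot (a i) p0 - b i + \sum_r (dot (a i) (p0 + row r B) - b i) = 0.
  have /eqP := slackp i; rewrite (eqP ti) subrr eq_sym mulf_eq0.
  by rewrite invr_eq0 gt_eqF //= => /eqP.
move/eqP: slack0; rewrite paddr_eq0 ?slack_ge0 ?sumr_ge0 //; last first.
  by move=> r _; exact: slack_ge0.
rewrite psumr_eq0 => [/andP [/eqP ap0 /allP aB]|r _]; last exact: slack_ge0.
have {}aB r : dot (a i) (row r B) = 0.
  have := aB r (mem_index_enum r); rewrite dotDr => /eqP; lra.
have orth (w : 'rV[R]_d) : (forall r, dot w (row r B) = 0) -> (w <= kermx B^T)%MS.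
  move=> wB; apply/sub_kermxP/rowP => r; rewrite [RHS]mxE -(wB r) mxE.
  by apply: eq_bigr => j _; rewrite !mxE.
exists i.
  have : (x - p0 <= kermx (a i)^T)%MS.
    apply: submx_trans (subB _ Fx) _; apply/row_subP => r.
    by rewrite sub_kermx_dot aB.
  by rewrite sub_kermx_dot dotBr /tight => /eqP xp; apply/eqP; lra.
have ker1 : \rank (kermx B^T) = 1%N.
  by rewrite mxrank_ker mxrank_tr (eqP freeB) -dk subSnn.
have kerB : (kermx B^T <= a i)%MS.
  have [_ <-] := mxrank_leqif_sup (orth _ aB).
  by rewrite ker1 rank_rV normal_neq0.
have /sub_rVP [l El] := submx_trans (orth _ uB) kerB.
have l_gt0 : 0 < l.
  have l0 : l != 0 by apply: contraNneq u0 => l0; rewrite El l0 scale0r.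
  rewrite lt_neqAle eq_sym l0 /=.
  have := valid _ polyh_interior; rewrite -/uR -up El !dotZl => h.
  have := o_int i; rewrite -(eqP ti) => h'.
  have : 0 <= l * (dot (a i) o - dot (a i) p) by lra.
  by rewrite pmulr_lge0 // subr_gt0.
exact: primitive_ratio l_gt0 El.
Qed.

Lemma normals_at_polyh x : (0 < d)%N -> polyh a b x ->
  normals_at (polyh a b) x = [set u | exists2 i, tight a b i x & u = aZ i].
Proof.
move=> d0 Px; apply/seteqP; split=> u /= [].
  by move=> F [fF Fx nu]; exact: facet_tightP nu.
move=> i /eqP ti ->; exists (polyh a b `&` [set y | dot (a i) y = b i]).
split; [exact: facet_tight|by []|split=> //].
by exists (b i); split=> // y; exact.
Qed.

End Normals.

(** * Odd integers and lattice bases *)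

Section OddInteger.
Variable R : realFieldType.
Implicit Types r : R.

Definition odd_integer r := exists k : int, r = 2 * k%:~R + 1.

Lemma odd_integer_nat n : odd n -> odd_integer n%:R.
Proof.
move=> on; exists n./2%:Z; rewrite -{1}(odd_double_half n) on.
by rewrite natrD -muln2 natrM addrC mulrC.
Qed.

Lemma odd_integerN r : odd_integer r -> odd_integer (- r).
Proof. by move=> [k ->]; exists (- k - 1); rewrite rmorphB rmorphN /=; ring. Qed.

Lemma odd_integer_sum (I : finType) (P : pred I) (F : I -> R) :
  (forall i, P i -> odd_integer (F i)) ->
  exists k : int, \sum_(i | P i) F i = 2 * k%:~R + #|P|%:R.
Proof.
move=> oddF.
pose f i := if pselect (P i) is left Pi then projT1 (cid (oddF i Pi)) else 0.
exists (\sum_(i | P i) f i).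
rewrite -sum1_card natr_sum rmorph_sum /= mulr_sumr -big_split.
apply: eq_bigr => i Pi; rewrite /f; case: pselect => // Pi'.
by case: cid.
Qed.

End OddInteger.

Section Zbasis.
Variable d : nat.
Implicit Types (S : set 'rV[int]_d) (u w z : 'rV[int]_d).

(** The matrix of these vectors is the identity up to signs and the row of [w],
so the coordinate on [w] is read off in column [j0] and then the others are. *)
Lemma Zbasis_star (eps : 'I_d -> int) w j0 S :
  (forall j, eps j * eps j = 1) -> w 0 j0 * w 0 j0 = 1 ->
  S = [set u | u = w \/ exists2 j, j != j0 & u = eps j *: delta_mx 0 j] ->
  Zbasis S.
Proof.
move=> eps2 w2 ->.
pose B : 'M[int]_d := \matrix_j if j == j0 then w else eps j *: delta_mx 0 j.
have rowB j : row j B = if j == j0 then w else eps j *: delta_mx 0 j.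
  exact: rowK.
exists d, B; split.
  apply/seteqP; split=> u /= [].
  - by move=> ->; exists j0; rewrite // rowB eqxx.
  - by move=> [j /negPf jj0 ->]; exists j; rewrite // rowB jj0.
  by move=> j _ <-; rewrite rowB; case: ifP => [|/negbT]; [left|right; exists j].
have mulB (k : 'rV[int]_d) l :
    (k *m B) 0 l = k 0 j0 * w 0 l + (if l == j0 then 0 else k 0 l * eps l).
  rewrite mxE (bigD1 j0) //= mxE eqxx; congr (_ + _).
  case: (eqVneq l j0) => [->|lj0].
    rewrite big1 // => j jj0; rewrite !mxE (negPf jj0) !mxE eqxx eq_sym.
    by rewrite (negPf jj0) !mulr0.
  rewrite (bigD1 l) //= big1 => [|j /andP [jj0 jl]].
    by rewrite !mxE (negPf lj0) !mxE !eqxx mulr1 addr0.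
  by rewrite !mxE (negPf jj0) !mxE eqxx eq_sym (negPf jl) !mulr0.
move=> z; exists (\row_j if j == j0 then z 0 j0 * w 0 j0
                   else (z 0 j - z 0 j0 * w 0 j0 * w 0 j) * eps j); split.
  apply/rowP => l; rewrite mulB !mxE eqxx.
  case: eqVneq => [->|_]; first by rewrite addr0 -mulrA w2 mulr1.
  by rewrite -(mulrA _ (eps l)) eps2 mulr1 addrC subrK.
move=> k ->; have k0 : k 0 j0 = (k *m B) 0 j0 * w 0 j0.
  by rewrite mulB eqxx addr0 -mulrA w2 mulr1.
apply/rowP => l; rewrite mxE -k0; case: eqVneq => [->//|lj0].
by rewrite mulB (negPf lj0) addrC addKr -mulrA eps2 mulr1.
Qed.

(** In a basis, [z] would have a coordinate equal to one half. *)
Lemma Zbasis_congr2 S u w z : Zbasis S -> S u -> S w -> u - w = 2 *: z -> u = w.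
Proof.
move=> [k [B [-> basis]]] [p _ <-] [q _ <-] E.
have [->//|pq] := eqVneq p q.
have [cz [zE _]] := basis z; have [e [_ uniq]] := basis (2 *: z).
have E1 := uniq (2 *: cz); have E2 := uniq (delta_mx 0 p - delta_mx 0 q).
rewrite -scalemxAl -zE in E1; rewrite mulmxBl -!rowE E in E2.
have /rowP/(_ p) : 2 *: cz = delta_mx 0 p - delta_mx 0 q by rewrite -E1 ?E2.
by rewrite !mxE !eqxx (negPf pq) /=; lia.
Qed.

(** Expanding [w] over the signed axes must give back the trivial expansion of the
basis vector [w], so [w] is one of these axes. *)
Lemma Zbasis_axes S (eps : 'I_d -> int) w : Zbasis S ->
  (forall j, eps j * eps j = 1) ->
  (forall j, S (eps j *: delta_mx 0 j)) -> S w ->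
  exists j, w = eps j *: delta_mx 0 j.
Proof.
move=> [k [B [-> basis]]] eps2 axes [p _ wp].
have qP j : exists q, row q B = eps j *: delta_mx 0 j.
  by have [q _ <-] := axes j; exists q.
pose q j := projT1 (cid (qP j)).
have qE j : row (q j) B = eps j *: delta_mx 0 j := projT2 (cid (qP j)).
have [e [_ uniq]] := basis w.
have e1 : e = delta_mx 0 p by apply: uniq; rewrite -rowE.
have e2 : e = \sum_j (w 0 j * eps j) *: delta_mx 0 (q j).
  apply: uniq; rewrite mulmx_suml {1}[w]row_sum_delta; apply: eq_bigr => j _.
  by rewrite -scalemxAl -rowE qE scalerA -mulrA eps2 mulr1.
have /rowP/(_ p) := etrans (esym e1) e2; rewrite mxE !eqxx summxE => E.
have [/existsP [j /eqP qj]|] := boolP [exists j, q j == p].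
  by exists j; rewrite -wp -qj qE.
rewrite negb_exists => /forallP noq; move/eqP: E; rewrite big1 // => j _.
by rewrite !mxE eqxx eq_sym (negPf (noq j)) mulr0.
Qed.

End Zbasis.

(** * The Hadamard polytope in the cube *)

Section HadamardPolytope.
Variables (R : realFieldType) (d : nat) (H : 'M[R]_d.+1) (c : 'I_d.+1).
Variables (m n : nat).
Hypothesis hH : hadamard H.
Hypotheses (n_gt0 : (0 < n)%N) (hnm : (n < m)%N) (hmd : (m < d * n)%N).

Local Notation v := (hvertex H c).

Lemma d_gt1 : (1 < d)%N.
Proof. by move: hnm hmd; case: d => [|[|]] //; lia. Qed.

Lemma sizes : [/\ 0 < n%:R :> R, n%:R < m%:R :> R, m%:R < d%:R * n%:R :> R
  & 1 < d%:R :> R].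
Proof. by rewrite ltr0n ltr_nat -natrM ltr_nat ltr1n d_gt1. Qed.

Lemma hvertex_sign i j : v i 0 j = 1 \/ v i 0 j = -1.
Proof.
rewrite hvertexE; case: (hH.1 i c) => ->; case: (hH.1 i (lift c j)) => ->.
- by left; rewrite mulr1.
- by right; rewrite mul1r.
- by right; rewrite mulr1.
- by left; rewrite mulrNN mulr1.
Qed.

Lemma hvertex_sqr i j : v i 0 j * v i 0 j = 1.
Proof. by case: (hvertex_sign i j) => ->; ring. Qed.

(** Two orthogonal rows of [d + 1] signs have a sum of products equal to 0, a sum
of [d + 1] odd numbers. *)
Lemma odd_dim : odd d.
Proof.
pose i1 : 'I_d.+1 := lift ord0 (Ordinal (ltnW d_gt1)).
have [k] : exists k : int,
    \sum_l H ord0 l * H i1 l =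
    2 * k%:~R + #|'I_d.+1|%:R.
  apply: (@odd_integer_sum R _ predT) => l _; rewrite /odd_integer.
  case: (hH.1 ord0 l) => ->; case: (hH.1 i1 l) => ->.
  - by exists 0; ring.
  - by exists (-1); ring.
  - by exists (-1); ring.
  - by exists 0; ring.
rewrite hadamard_row // (negPf (neq_lift _ _)) mulr0 card_ord => /esym E.
have : 2 * k + d.+1%:Z = 0.
  apply/eqP; rewrite -(eqr_int R) rmorphD rmorphM /=; exact/eqP.
lia.
Qed.

Definition hvertexZ i : 'rV[int]_d := \row_j (if v i 0 j == 1 then 1 else -1).

Lemma hvertexZE i j : (hvertexZ i 0 j)%:~R = v i 0 j.
Proof.
rewrite mxE; case: eqP => [-> //|]; case: (hvertex_sign i j) => -> //.
Qed.

Lemma map_hvertexZ i : map_mx intr (hvertexZ i) = v i.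
Proof. by apply/rowP => j; rewrite mxE hvertexZE. Qed.

Lemma hvertexZ_sign i j : hvertexZ i 0 j = 1 \/ hvertexZ i 0 j = -1.
Proof. by rewrite mxE; case: ifP; [left|right]. Qed.

Lemma hvertexZ_sqr i j : hvertexZ i 0 j * hvertexZ i 0 j = 1.
Proof. by case: (hvertexZ_sign i j) => ->. Qed.

Definition normal (t : 'I_d.+1 + 'I_d * bool) : 'rV[int]_d :=
  match t with
  | inl i => hvertexZ i
  | inr (j, s) => (-1) ^+ s *: delta_mx 0 j
  end.

Local Notation a := (fun t => map_mx intr (normal t) : 'rV[R]_d).

Lemma dot_inl i x : dot (map_mx intr (normal (inl i))) x = dot (v i) x.
Proof. by rewrite /= map_hvertexZ. Qed.

Lemma dot_inr j (s : bool) (x : 'rV[R]_d) :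
  dot (map_mx intr (normal (inr (j, s)))) x = (-1) ^+ s * x 0 j.
Proof.
rewrite /= map_mxZ map_delta_mx rmorph_sign dotZl dotC dot_delta //.
Qed.

Definition Poff (t : 'I_d.+1 + 'I_d * bool) : R :=
  match t with inl i => - m%:R | inr _ => - n%:R end.

Definition Qoff (t : 'I_d.+1 + 'I_d * bool) : R :=
  match t with
  | inl i => bQ H c m n i
  | inr (j, s) => if s then - n%:R else 0
  end.

Lemma PmnE : Pmn H c m n = polyh a Poff.
Proof.
have [nR nmR _ _] := sizes.
have m0 : 0 < (m%:R : R) by lra.
apply/seteqP; split=> [_ [[z + <-] cx] [i|[j s]]|x Px].
- rewrite hsimplexE // => /(_ i) h; rewrite dot_inl dotZr /=.
  by rewrite -mulrN1 ler_pM2l.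
- by rewrite dot_inr /=; have := cx j; case: s => /=; lra.
split; last first.
  by move=> j; have := Px (inr (j, true)); have := Px (inr (j, false)); rewrite !dot_inr /=; lra.
exists (m%:R^-1 *: x); last by rewrite scalerA mulfV ?scale1r // gt_eqF.
rewrite hsimplexE // => i; rewrite dotZr -(ler_pM2l m0) mulrA mulfV ?gt_eqF //.
by rewrite mul1r mulrN1; have := Px (inl i); rewrite dot_inl.
Qed.

Lemma QmnE : Qmn H c m n = polyh a Qoff.
Proof.
apply/seteqP; split=> [y [cy hy] [i|[j s]]|y Py].
- by rewrite dot_inl; exact: hy.
- by rewrite dot_inr /=; have := cy j; case: s => /=; lra.
split=> [j|i]; last by have := Py (inl i); rewrite dot_inl.
by have := Py (inr (j, true)); have := Py (inr (j, false)); rewrite !dot_inr /=; lra.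
Qed.

Lemma slack_chart t x :
  dot (a t) (chart n x) - Qoff t = 2^-1 * (dot (a t) x - Poff t).
Proof.
case: t => [i|[j s]].
  rewrite !dot_inl /chart /= /bQ dotZr dotDr.
  have -> : dot (v i) (const_mx n%:R) = n%:R * \sum_j v i 0 j.
    by rewrite mulr_sumr; apply: eq_bigr => j _; rewrite [const_mx _ _ _]mxE mulrC.
  by ring.
by rewrite !dot_inr !mxE /=; case: s => /=; field.
Qed.

Lemma tight_chart t x : tight a Qoff t (chart n x) = tight a Poff t x.
Proof.
rewrite /tight -[LHS]subr_eq0 slack_chart mulf_eq0 invr_eq0 pnatr_eq0 /=.
exact: subr_eq0.
Qed.

Lemma polyh_chart x : polyh a Qoff (chart n x) <-> polyh a Poff x.
Proof.
have E t : (Qoff t <= dot (a t) (chart n x)) = (Poff t <= dot (a t) x).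
  by rewrite -subr_ge0 slack_chart pmulr_rge0 ?invr_gt0 ?ltr0n // subr_ge0.
by split=> h t; have := h t; rewrite E.
Qed.

Lemma vertex_chart x :
  vertex (Qmn H c m n) (chart n x) <-> vertex (Pmn H c m n) x.
Proof.
rewrite PmnE QmnE !vertex_polyhP polyh_chart.
by split=> -[Px full]; split=> // z kill; apply: full => t;
  have := kill t; rewrite tight_chart.
Qed.

Lemma chart_surj y : exists x : 'rV[R]_d, y = chart n x.
Proof.
by exists (2 *: y - const_mx n%:R); apply/rowP => j; rewrite !mxE; field.
Qed.

Lemma primitive_normal_entry (u : 'rV[int]_d) j : absz (u 0 j) = 1%N -> primitive u.
Proof. by move=> uj; rewrite /primitive (bigD1 j) //= uj gcd1n. Qed.

(** Each normal belongs to a facet, as the point [p] below is on its hyperplane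
and strictly inside the other ones; the chart image of 0 is an interior point. *)
Lemma normals_chart x : polyh a Poff x ->
  normals_at (Qmn H c m n) (chart n x) =
  [set u | exists2 t, tight a Poff t x & u = normal t].
Proof.
have [nR nmR mdR dR] := sizes.
move=> Px; rewrite QmnE.
have prim t : primitive (normal t).
  move: t; move=> [i|[j s]] /=.
    apply: (@primitive_normal_entry _ (Ordinal (ltnW d_gt1))).
    by rewrite mxE; case: ifP.
  apply: (@primitive_normal_entry _ j).
  by rewrite !mxE !eqxx; case: s.
have o_int t : Qoff t < dot (a t) (chart n 0).
  rewrite -subr_gt0 slack_chart dot0r sub0r.
  rewrite pmulr_rgt0 ?invr_gt0 ?ltr0n // oppr_gt0.
  by case: t => [i|[j s]] /=; lra.
have irredundant t : exists2 y, polyh a Qoff y &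
    forall t', tight a Qoff t' y = (t' == t).
  pose p : 'rV[R]_d := match t with
    | inl i => - (m%:R / d%:R) *: v i
    | inr (j, s) => (- (-1) ^+ s * n%:R) *: delta_mx 0 j end.
  suff slack t' : if t' == t then dot (a t') p = Poff t'
                  else Poff t' < dot (a t') p.
    exists (chart n p).
      by apply/polyh_chart => t'; have := slack t'; case: ifP => [_ ->|_ /ltW].
    move=> t'; rewrite tight_chart /tight; have := slack t'.
    by case: eqP => _ h; [exact/eqP|rewrite gt_eqF].
  have md0 : 0 < m%:R / d%:R :> R by rewrite divr_gt0; lra.
  have mdn : m%:R / d%:R < n%:R :> R by rewrite ltr_pdivrMr; lra.
  have dmd : d%:R * (m%:R / d%:R) = m%:R :> R by rewrite mulrCA mulfV ?mulr1; lra.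
  have vn i j : - (n%:R : R) <= v i 0 j * n%:R <= n%:R.
    by case: (hvertex_sign i j) => ->; lra.
  rewrite /p; case: t {p} => [i|[j s]]; case: t' => [k|[l r]].
  + rewrite dot_inl dotZr dot_hvertex // (inj_eq inl_inj) -natr1.
    by case: eqP => _ /=; nra.
  + by rewrite dot_inr mxE /=; case: (hvertex_sign i l) => ->; case: r => /=; lra.
  + rewrite dot_inl dotZr dot_delta /=; have := vn k j.
    by case: s => /=; lra.
  rewrite dot_inr !mxE /= (inj_eq inr_inj) xpair_eqE; case: (eqVneq l j) => [_|_] /=.
    by case: r; case: s => /=; lra.
  by rewrite !mulr0; lra.
rewrite (normals_at_polyh prim o_int irredundant) ?(ltnW d_gt1) //; last exact/polyh_chart.
by apply/seteqP; split=> u [t tt ->]; exists t => //; move: tt; rewrite tight_chart.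
Qed.

Implicit Types (x y z : 'rV[R]_d).

Definition extreme (x : 'rV[R]_d) j := x 0 j = n%:R \/ x 0 j = - n%:R.

Lemma tight_inl i x : tight a Poff (inl i) x <-> dot (v i) x = - m%:R.
Proof. by rewrite /tight dot_inl; split=> [/eqP|->]. Qed.

Lemma tight_inr j s x : tight a Poff (inr (j, s)) x <-> x 0 j = - (-1) ^+ s * n%:R.
Proof.
rewrite /tight dot_inr; split=> [/eqP /=|->]; first by case: s => /=; lra.
by case: s => /=; apply/eqP; ring.
Qed.

Lemma tight_extreme j s x : tight a Poff (inr (j, s)) x -> extreme x j.
Proof. by rewrite /extreme => /tight_inr ->; case: s; [left|right]; ring. Qed.

Lemma extreme_tight x j : extreme x j -> exists s, tight a Poff (inr (j, s)) x.
Proof.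
by case=> xj; [exists true|exists false]; apply/tight_inr; rewrite xj /=; ring.
Qed.

Lemma polyh_cube x : polyh a Poff x -> forall j, - n%:R <= x 0 j <= n%:R.
Proof. by rewrite -PmnE => -[]. Qed.

(** For signs, [|v i j + v k j| = 1 + v i j * v k j], and the sum over [j] is
[d + v i . v k = d - 1]. *)
Lemma dot_pair_ge i k x : i != k -> (forall j, - n%:R <= x 0 j <= n%:R) ->
  - ((d%:R - 1) * n%:R) <= dot (v i) x + dot (v k) x.
Proof.
move=> /negPf ik cx.
have -> : d%:R - 1 = \sum_j (1 + v i 0 j * v k 0 j).
  rewrite big_split /= sumr_const card_ord -/(dot _ _) dot_hvertex // ik.
  by rewrite mulr0 sub0r.
rewrite -dotDl mulr_suml -sumrN; apply: ler_sum => j _; rewrite [(v i + v k) 0 j]mxE.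
have := cx j; case: (hvertex_sign i j) => ->; case: (hvertex_sign k j) => ->; lra.
Qed.

Lemma Lambda_odd x : odd n -> (forall j, odd_integer (x 0 j)) -> Lambda n x.
Proof.
move=> on ox j; have [k ->] := ox j; exists (k - n./2%:Z).
rewrite -{1}(odd_double_half n) on natrD -muln2 natrM rmorphB /=.
by ring.
Qed.

Lemma extreme_odd x j : odd n -> extreme x j -> odd_integer (x 0 j).
Proof.
move=> /(odd_integer_nat R) on.
by case=> ->; [exact: on | exact: odd_integerN].
Qed.

Lemma cube_vertex x : polyh a Poff x -> (forall j, extreme x j) ->
  vertex (Pmn H c m n) x.
Proof.
move=> Px ext; rewrite PmnE; apply/vertex_polyhP; split=> // z kill.
apply/rowP => j; rewrite [RHS]mxE; have [s /kill] := extreme_tight (ext j).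
by rewrite dot_inr => /eqP; rewrite mulf_eq0 signr_eq0 => /eqP.
Qed.

Section LargeDilation.
Hypothesis large : (d%:R - 1) / 2 * n%:R < m%:R :> R.

Lemma tight_inl_unique i k x : polyh a Poff x ->
  dot (v i) x = - m%:R -> dot (v k) x = - m%:R -> i = k.
Proof.
move=> /polyh_cube cx vi vk; apply/eqP/negPn/negP => ik.
have := dot_pair_ge ik cx; rewrite vi vk.
by move: large; nra.
Qed.

(** If [j0] is not extreme, the axis [j0] is not killed by the tight normals, so some
[v i] is tight, and it is the only one.  If [j1] were not extreme either, the
combination of the axes [j0] and [j1] orthogonal to [v i] would be killed by all
tight normals. *)
Lemma vertex_coords x : vertex (Pmn H c m n) x -> exists j0,
  (forall j, j != j0 -> extreme x j) /\
  (extreme x j0 \/ exists i, dot (v i) x = - m%:R).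
Proof.
rewrite PmnE => /vertex_polyhP [Px full].
have [ext|/existsNP [j0 nj0]] := pselect (forall j, extreme x j).
  by exists (Ordinal (ltnW d_gt1)); split=> *; [|left]; exact: ext.
have facet_j0 (z : 'rV[R]_d) : z != 0 -> (forall j, extreme x j -> z 0 j = 0) ->
    exists2 i, dot (v i) x = - m%:R & dot (v i) z != 0.
  move=> z0 zext; apply: contrapT => no; case/eqP: z0; apply: full => -[i|[j s]] t.
    rewrite dot_inl; apply/eqP/negPn/negP => iz.
    by apply: no; exists i => //; apply/tight_inl.
  by rewrite dot_inr (zext j) ?mulr0 //; exact: tight_extreme t.
have [|j /= ej|i vi _] := facet_j0 (delta_mx 0 j0).
- by apply/rV0Pn; exists j0; rewrite mxE !eqxx oner_eq0.
- by rewrite mxE eqxx; case: eqP => // jj0; case: nj0; rewrite -jj0.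
exists j0; split; last by right; exists i.
move=> j1; rewrite eq_sym => j01; apply: contrapT => nj1.
pose z : 'rV[R]_d := v i 0 j1 *: delta_mx 0 j0 - v i 0 j0 *: delta_mx 0 j1.
have zE l : z 0 l = v i 0 j1 * (l == j0)%:R - v i 0 j0 * (l == j1)%:R.
  by rewrite /z; move: (v i 0 j1) (v i 0 j0) => p q; rewrite !mxE eqxx.
have [|j ej|k vk] := facet_j0 z.
- apply/rV0Pn; exists j0; rewrite zE eqxx (negPf j01) mulr0 subr0 mulr1.
  by case: (hvertex_sign i j1) => ->; rewrite ?oppr_eq0 oner_eq0.
- rewrite zE; case: eqP => [jj|_]; first by case: nj0; rewrite -jj.
  by case: eqP => [jj|_]; [case: nj1; rewrite -jj | rewrite !mulr0 subr0].
rewrite -(tight_inl_unique Px vi vk) dotBr !dotZr !dot_delta.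
by rewrite mulrC subrr eqxx.
Qed.

(** The exceptional coordinate is, up to sign, [- m] minus a sum of [d - 1] odd
integers, where [m] is odd and [d - 1] is even. *)
Lemma lattice_large : odd m -> odd n -> lattice_polytope_P H c m n.
Proof.
move=> om on x vx; have [j0 [ext j0P]] := vertex_coords vx.
apply: Lambda_odd => // j; have [->|/ext] := eqVneq j j0; last exact: extreme_odd.
case: j0P => [|[i vi]]; first exact: extreme_odd.
have odd_sgn l r : odd_integer r -> odd_integer (v i 0 l * r).
  move=> or; case: (hvertex_sign i l) => ->; rewrite ?mul1r // mulN1r.
  exact: odd_integerN.
have -> : x 0 j0 = v i 0 j0 * (v i 0 j0 * x 0 j0).
  by rewrite mulrA hvertex_sqr mul1r.
apply: (odd_sgn j0); move: vi; rewrite /dot (bigD1 j0) //=.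
have [k ->] := @odd_integer_sum R _ (fun l => l != j0) (fun l => v i 0 l * x 0 l)
  (fun l lj0 => odd_sgn l _ (extreme_odd on (ext l lj0))).
have [k' ->] := odd_integer_nat R om.
have -> : #|(fun l => l != j0) : pred 'I_d| = (d./2).*2.
  have := cardC1 j0; rewrite card_ord => ->.
  by rewrite -{1}(odd_double_half d) odd_dim.
rewrite -muln2 natrM => E; exists (- k' - k - d./2%:Z - 1).
rewrite !rmorphB rmorphN /=; lra.
Qed.

End LargeDilation.

(** The quotient [- m / n] is a sum of [d] signs, and [d] is odd. *)
Lemma cube_vertex_ratio x i : (forall j, extreme x j) -> dot (v i) x = - m%:R ->
  odd_integer (m%:R / n%:R : R).
Proof.
have [nR _ _ _] := sizes.
move=> ext vi.
have [|k E] := @odd_integer_sum R _ predT (fun j => v i 0 j * (x 0 j / n%:R)).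
  move=> j _; case: (ext j) => ->; case: (hvertex_sign i j) => ->;
    rewrite ?mulNr mulfV ?gt_eqF //.
  - by exists 0; ring.
  - by exists (-1); ring.
  - by exists (-1); ring.
  - by exists 0; ring.
have {}E : - (m%:R / n%:R) = 2 * k%:~R + d%:R :> R.
  rewrite -mulNr -vi mulr_suml -[d in RHS]card_ord -E.
  by apply: eq_bigr => j _; rewrite mulrA.
rewrite -[m%:R / n%:R]opprK E; apply: odd_integerN.
have [k' ->] := odd_integer_nat R odd_dim.
by exists (k + k'); rewrite rmorphD /=; ring.
Qed.

Lemma smooth_large : odd m -> odd n -> (d%:R - 1) / 2 * n%:R < m%:R :> R ->
  ~ odd_integer (m%:R / n%:R : R) -> smooth_P H c m n.
Proof.
have [nR nmR mdR dR] := sizes.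
move=> om on large not_odd; split; first exact: lattice_large.
move=> y; have [x ->] := chart_surj y; move=> /vertex_chart vx.
have [j0 [ext j0P]] := vertex_coords large vx.
have Px : polyh a Poff x by move: vx; rewrite PmnE => /vertex_polyhP [].
rewrite normals_chart //.
(* The inner normal of the cube facet [x j = n] is the negative axis. *)
pose eps j : int := if x 0 j == n%:R then -1 else 1.
have eps2 j : eps j * eps j = 1 by rewrite /eps; case: ifP => _; ring.
have tight_eps j s : tight a Poff (inr (j, s)) x -> (-1) ^+ s = eps j.
  move/tight_inr => xj; rewrite /eps xj; case: s {xj} => /=.
    by rewrite opprK mul1r eqxx.
  by rewrite ifF //; apply/eqP; lra.
have eps_tight j : extreme x j ->
    exists2 t, tight a Poff t x & eps j *: delta_mx 0 j = normal t.
  by move=> /extreme_tight [s t]; exists (inr (j, s)); rewrite //= (tight_eps _ _ t).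
have [e0|ne0] := pselect (extreme x j0).
  apply: (@Zbasis_star _ eps (eps j0 *: delta_mx 0 j0) j0) => //.
    by rewrite !mxE !eqxx mulr1 eps2.
  have ext' j : extreme x j by have [->|/ext] := eqVneq j j0.
  apply/seteqP; split=> u /=.
    move=> [[i|[j s]] t ->].
      by case: not_odd; apply: cube_vertex_ratio ext' _; apply/tight_inl; exact: t.
    rewrite /= (tight_eps _ _ t); have [->|jj0] := eqVneq j j0; first by left.
    by right; exists j.
  by case=> [->|[j _ ->]]; exact: eps_tight.
case: j0P => // -[i vi].
apply: (@Zbasis_star _ eps (hvertexZ i) j0) => //; first exact: hvertexZ_sqr.
apply/seteqP; split=> u /=.
  move=> [[k|[j s]] t ->].
    by left; rewrite (tight_inl_unique large Px vi (proj1 (tight_inl k x) t)).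
  right; exists j; last by rewrite /= (tight_eps _ _ t).
  by apply/negP => /eqP jj0; apply: ne0; rewrite -jj0; exact: tight_extreme t.
case=> [->|[j jj0 ->]]; last exact/eps_tight/ext.
by exists (inl i) => //; apply/tight_inl.
Qed.

Lemma hvertexZ_inj : injective hvertexZ.
Proof.
have [_ _ _ dR] := sizes.
move=> i k ik; apply/eqP/negPn/negP => /negPf nik.
have := dot_hvertex c hH i k; rewrite -(map_hvertexZ i) ik map_hvertexZ.
by rewrite dot_hvertex // eqxx nik /= mulr1 mulr0 -natr1; lra.
Qed.

(** The starting point is the barycentre of the face of [m] times the simplex
opposite to the vertices [i] and [k]; the threshold is what puts it in the cube. *)
Lemma smooth_imp_large : smooth_P H c m n ->
  (d%:R - 1) / 2 * n%:R < m%:R :> R.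
Proof.
have [nR nmR mdR dR] := sizes.
move=> [_ smooth]; rewrite ltNge; apply/negP => small.
pose i : 'I_d.+1 := ord0; pose k : 'I_d.+1 := ord_max.
have ik : i != k by rewrite -val_eqE /= eq_sym -lt0n ltnW ?d_gt1.
pose e : R := m%:R / (d%:R - 1).
have eE : e * (d%:R - 1) = m%:R by rewrite /e mulfVK //; lra.
have e0 : 0 < e by rewrite divr_gt0; lra.
have en : e * 2 <= n%:R.
  by rewrite -(ler_pM2r (_ : 0 < d%:R - 1)); [rewrite mulrAC eE|]; lra.
pose x0 := - e *: (v i + v k).
have dotx l : dot (v l) x0 = - e * ((d.+1%:R * (l == i)%:R - 1) +
                                    (d.+1%:R * (l == k)%:R - 1)).
  by rewrite dotZr dotDr !dot_hvertex.
have Px0 : polyh a Poff x0.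
  move=> [l|[j s]]; rewrite ?dot_inl ?dot_inr /=.
    rewrite dotx -natr1; case: (eqVneq l i) => [->|_].
      by rewrite (negPf ik) /=; nra.
    by case: (l == k) => /=; nra.
  rewrite [x0 0 j]mxE [(v i + v k) 0 j]mxE.
  by case: (hvertex_sign i j) => ->; case: (hvertex_sign k j) => ->;
    case: s => /=; lra.
have ti : tight a Poff (inl i) x0.
  by apply/tight_inl; rewrite dotx eqxx (negPf ik) -natr1 -eE /=; ring.
have tk : tight a Poff (inl k) x0.
  by apply/tight_inl; rewrite dotx eqxx (eq_sym k) (negPf ik) -natr1 -eE /=; ring.
have [|x vx old] := @exists_vertex _ _ _ a Poff x0 _ Px0.
  move=> z /rV0Pn [j zj]; exists (inr (j, 0 < z 0 j)); rewrite dot_inr.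
  case: (ltgtP 0 (z 0 j)) => [zj0|zj0|zj0] /=; [by lra|by lra|].
  by rewrite -zj0 eqxx in zj.
have Px : polyh a Poff x by move/vertex_polyhP: vx => [].
have := smooth (chart n x); rewrite normals_chart // vertex_chart PmnE => /(_ vx) basis.
case/eqP: ik; apply: hvertexZ_inj.
(* Half the difference of the two rows *)
pose z : 'rV[int]_d :=
  \row_j if hvertexZ i 0 j == hvertexZ k 0 j then 0 else hvertexZ i 0 j.
apply: (Zbasis_congr2 (z := z) basis).
- by exists (inl i) => //; exact: old.
- by exists (inl k) => //; exact: old.
apply/rowP => j; rewrite [LHS]mxE [(- hvertexZ k) 0 j]mxE [RHS]mxE [z 0 j]mxE.
by case: (hvertexZ_sign i j) => ->; case: (hvertexZ_sign k j) => ->.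
Qed.

(** If [m = (2 q + 1) n], flipping the sign of all but [(d - 1) / 2 - q] entries of
[n * v i] gives a cube vertex with [v i . x = - m]. *)
Lemma smooth_imp_not_odd : smooth_P H c m n -> ~ odd_integer (m%:R / n%:R : R).
Proof.
have [nR nmR mdR dR] := sizes.
move=> sm; have large := smooth_imp_large sm; case: sm => _ smooth [q qE].
have {}qE : m%:Z = n%:Z * (2 * q + 1).
  apply/eqP; rewrite -(eqr_int R) rmorphM rmorphD rmorphM /= -qE.
  by rewrite mulrCA mulfV ?mulr1 // gt_eqF.
have [e eP] : exists e : nat, (e <= d)%N /\ m%:R = (d%:R - 2 * e%:R) * n%:R :> R.
  have od := odd_dim; have [q' q'E] : exists q' : nat, q = q'%:Z.
    exists (absz q); nia.
  have qd : (q' < d./2)%N by nia.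
  exists (d./2 - q')%N; split; first lia.
  have -> : m = (n * (2 * q' + 1))%N by lia.
  have -> : d%:R = (1 + d./2 * 2)%:R :> R by rewrite muln2 -{1}(odd_double_half d) od.
  by rewrite natrB ?(ltnW qd) // natrM !natrD !natrM; ring.
pose i : 'I_d.+1 := ord0.
pose x : 'rV[R]_d := \row_j (if (j < e)%N then v i 0 j * n%:R else - (v i 0 j * n%:R)).
have ext j : extreme x j.
  rewrite /extreme mxE; case: ifP => _; case: (hvertex_sign i j) => ->;
    by [left; ring|right; ring].
have vi : dot (v i) x = - m%:R.
  rewrite eP.2 /dot.
  have -> : \sum_j v i 0 j * x 0 j = \sum_(j < d) (2 * (j < e)%:R - 1) * n%:R.
    apply: eq_bigr => j _; rewrite [x 0 j]mxE; have := hvertex_sqr i j.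
    by case: ifP => _ /= v2; rewrite ?mulrN mulrA v2; ring.
  rewrite -mulr_suml sumrB -mulr_sumr sumr_const card_ord -natr_sum.
  have -> : (\sum_(j < d) (j < e) = e)%N.
    transitivity (\sum_(j < d | (j < e)%N) 1)%N.
      by rewrite [RHS]big_mkcond; apply: eq_bigr => j _; case: ifP.
    by rewrite -(big_ord_widen d (fun _ => 1%N)) ?eP.1 // sum1_card card_ord.
  by ring.
have cx j : - n%:R <= x 0 j <= n%:R by case: (ext j) => ->; lra.
have Px : polyh a Poff x.
  move=> [l|[j s]]; rewrite ?dot_inl ?dot_inr /=; last first.
    by have := cx j; case: s => /=; lra.
  have [->|li] := eqVneq l i; first by rewrite vi.
  by have := dot_pair_ge li cx; rewrite vi; move: large; lra.
have vx := cube_vertex Px ext.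
have := smooth (chart n x); rewrite normals_chart // vertex_chart => /(_ vx) basis.
pose eps j : int := if x 0 j == n%:R then -1 else 1.
have [|||j wj] := Zbasis_axes (eps := eps) (w := hvertexZ i) basis.
- by move=> j; rewrite /eps; case: ifP => _; ring.
- move=> j; exists (inr (j, x 0 j == n%:R)); last by rewrite /= /eps; case: ifP.
  apply/tight_inr; case: eqP (ext j) => [-> _|no [//|->]] /=; ring.
- by exists (inl i) => //; apply/tight_inl.
have [l lj] : exists l, l != j.
  have d0 := ltnW d_gt1.
  have [j0|] := eqVneq j (Ordinal d0); last by exists (Ordinal d0); rewrite eq_sym.
  by exists (Ordinal d_gt1); rewrite j0.
have := hvertexZ_sqr i l; rewrite wj !mxE (negPf lj) andbF mulr0 mul0r.
by [].
Qed.

End HadamardPolytope.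

Theorem theorem2p6 (R : realType) (d : nat) (H : 'M[R]_d.+1) (c : 'I_d.+1)
    (m n : nat) (hH : hadamard H) (hm : odd m) (hn : odd n)
    (hnm : (n < m)%N) (hmd : (m < d * n)%N) :
  (smooth_P H c m n <->
     ((d%:R - 1) / 2 * n%:R < m%:R :> R) /\
     ~ (exists k : int, m%:R / n%:R = 2 * k%:~R + 1 :> R)) /\
  ((d%:R - 1) / 2 * n%:R < m%:R :> R -> lattice_polytope_P H c m n).
Proof.
have n_gt0 : (0 < n)%N by rewrite lt0n; apply: contraTneq hn => ->.
split=> [|large]; last exact: lattice_large.
split=> [sm|[large not_odd]]; last exact: smooth_large.
by split; [exact: smooth_imp_large sm|exact: smooth_imp_not_odd sm].
Qed.
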